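(* Let $X_1,\dots,X_m\subseteq\mathbb{R}^n$ be closed convex sets such that there exists $1\le r\le m$ with $X_{r+1},\dots,X_m$ polyhedral and there exists $\bar x\in\left(\bigcap_{i=1}^r \mathrm{ri}(X_i)\right)\cap\left(\bigcap_{i=r+1}^m X_i\right)$. Let $g:\mathbb{R}^n\to\mathbb{R}$ be $1$-strongly convex with $L$-Lipschitz continuous gradient. Let $y^0\in\mathbb{R}^{mn}$ and let $\sigma>0$ be a constant (which exists under these hypotheses) for which the quadratic growth condition $$d(y)-d^*\ge\frac{\sigma}{2}\mathrm{dist}^2(y,Y^* )\qquad\text{for all } y \text{ with } d(y)\le d(y^0)$$ holds. Then the sequence $\{y^k\}_{k\ge0}$ generated by the RCD algorithm started at $y^0$ satisfies $$\mathbb{E}[d(y^k)-d^*]\le\left(1-\frac{\sigma}{m(\sigma+1)}\right)^k\left(d(y^0)-d^*+\frac12\mathrm{dist}^2(y^0,Y^* )\right)\qquad\text{for all } k\ge0.$$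
   Context: For $y=(y_1;\dots;y_m)\in\mathbb{R}^{mn}$ (blocks $y_i\in\mathbb{R}^n$), $d(y)=\tilde d(y)+\sum_{i=1}^m\mathrm{supp}_{X_i}(y_i)$ with $\tilde d(y)=g^*\left(-\sum_{i=1}^m y_i\right)$, where $g^*$ is the Fenchel conjugate and $\mathrm{supp}_X(z)=\sup_{x\in X}\langle z,x\rangle$. $d^*=\min_y d(y)$, $Y^*=\arg\min_y d(y)$, $\mathrm{dist}(y,Y)=\min_{z\in Y}\|z-y\|$, $\mathrm{ri}$ is the relative interior. The partial gradient is $\nabla_i\tilde d(y)=-\nabla g^*\left(-\sum_{j=1}^m y_j\right)$. For a convex function $h$, $\mathrm{prox}_h(w)=\arg\min_z\{\frac12\|z-w\|^2+h(z)\}$. RCD algorithm (random coordinate descent): given $y^0$, for $k\ge0$ choose an index $i_k\in\{1,\dots,m\}$ uniformly at random (independently of the previous choices) and set $$y^{k+1}_{i_k}=\mathrm{prox}_{\mathrm{supp}_{X_{i_k}}}\left(y^k_{i_k}-\nabla_{i_k}\tilde d(y^k)\right),\qquad y^{k+1}_j=y^k_j\ \ \text{for all } j\ne i_k.$$ *)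

(* Defs.v *)
From HB Require Import structures.
From mathcomp Require Import all_boot all_order all_algebra.
From mathcomp Require Import finmap.
From mathcomp Require Import all_classical all_reals all_analysis.

Set Implicit Arguments.
Unset Strict Implicit.
Unset Printing Implicit Defensive.

Import Order.TTheory GRing.Theory Num.Theory.
Import numFieldNormedType.Exports.

Local Open Scope classical_set_scope.
Local Open Scope ring_scope.

Section Euclidean.
Context {R : realType}.

(* The norm that the library puts on matrices is the sup norm, hence the
   Euclidean structure below.  A point (y_1; ...; y_m) of R^(mn) is encoded as
   the m x n matrix whose i-th row is y_i, a point of R^n as a row vector. *)
Definition dot {m n : nat} (u v : 'M[R]_(m, n)) : R :=
  \sum_(i < m) \sum_(j < n) u i j * v i j.

Definition enorm {m n : nat} (u : 'M[R]_(m, n)) : R := Num.sqrt (dot u u).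

Definition argmin {T : Type} (f : T -> \bar R) : set T :=
  [set x | forall z, (f x <= f z)%E].

(* +oo when Y is empty *)
Definition dist {m n : nat} (y : 'M[R]_(m, n)) (Y : set 'M[R]_(m, n)) : \bar R :=
  ereal_inf [set (enorm (z - y))%:E | z in Y].

End Euclidean.

Section ConvexAnalysis.
Context {R : realType} {n : nat}.
Implicit Types (A X : set 'rV[R]_n) (f g : 'rV[R]_n -> R).

Definition affine_hull A : set 'rV[R]_n :=
  [set x | exists (k : nat) (t : 'I_k -> R) (p : 'I_k -> 'rV[R]_n),
    [/\ forall i, A (p i), \sum_(i < k) t i = 1
      & x = \sum_(i < k) t i *: p i]].

Definition relint A : set 'rV[R]_n :=
  [set x | A x /\ exists2 e : R, 0 < e &
    forall z, affine_hull A z -> enorm (z - x) < e -> A z].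

Definition polyhedral A : Prop :=
  exists (p : nat) (a : 'I_p -> 'rV[R]_n) (b : 'I_p -> R),
    A = [set x | forall j, dot (a j) x <= b j].

Definition strongly_convex (mu : R) g : Prop :=
  forall (x y : 'rV[R]_n) (t : R), 0 <= t <= 1 ->
    g (t *: x + (1 - t) *: y) <=
      t * g x + (1 - t) * g y
      - mu / 2 * t * (1 - t) * enorm (x - y) ^+ 2.

Definition grad f (x : 'rV[R]_n) : 'rV[R]_n :=
  \row_(j < n) 'D_(delta_mx 0 j) f x.

Definition lipschitz_gradient (L : R) f : Prop :=
  (forall x, differentiable f x) /\
  (forall x y, enorm (grad f x - grad f y) <= L * enorm (x - y)).

Definition conjugate g (z : 'rV[R]_n) : \bar R :=
  ereal_sup [set (dot z x - g x)%:E | x in [set: 'rV[R]_n]].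

Definition supp X (z : 'rV[R]_n) : \bar R :=
  ereal_sup [set (dot z x)%:E | x in X].

(* When the minimizer does not exist this is the arbitrary value 0; for the
   support function of a nonempty closed convex set it exists and is unique. *)
Definition prox (h : 'rV[R]_n -> \bar R) (w : 'rV[R]_n) : 'rV[R]_n :=
  xget 0 (argmin (fun z => ((2^-1 * enorm (z - w) ^+ 2)%:E + h z)%E)).

End ConvexAnalysis.

Section RCD.
Context {R : realType} {m n : nat}.
Variables (X : 'I_m -> set 'rV[R]_n) (g : 'rV[R]_n -> R).
Implicit Type y : 'M[R]_(m, n).

Definition dual_smooth y : \bar R := conjugate g (- \sum_(i < m) row i y).

Definition dual y : \bar R :=
  (dual_smooth y + \sum_(i < m) supp (X i) (row i y))%E.

Definition dual_opt : \bar R := ereal_inf (range dual).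

Definition dual_sol : set 'M[R]_(m, n) := argmin dual.

(* The value is the same for every block i, because dual_smooth depends on y
   only through the sum of its blocks; fine is harmless as the conjugate of a
   strongly convex function is finite everywhere. *)
Definition dual_partial_grad (i : 'I_m) y : 'rV[R]_n :=
  - grad (fun z => fine (conjugate g z)) (- \sum_(j < m) row j y).

Definition rcd_step (i : 'I_m) y : 'M[R]_(m, n) :=
  \matrix_(j < m) if j == i
    then prox (supp (X i)) (row i y - dual_partial_grad i y)
    else row j y.

Fixpoint rcd (y0 : 'M[R]_(m, n)) (ik : nat -> 'I_m) (k : nat) : 'M[R]_(m, n) :=
  if k is k'.+1 then rcd_step (ik k') (rcd y0 ik k') else y0.

End RCD.

Section Sampling.
Context {R : realType} {dis : measure_display} {Omega : measurableType dis}.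
Variable P : probability Omega R.
Context {m : nat}.
Variable ik : nat -> Omega -> 'I_m.

Definition mutually_independent : Prop :=
  forall (K : {fset nat}) (A : nat -> set 'I_m),
    P (\bigcap_(k in [set` K]) (ik k @^-1` A k)) =
    (\prod_(k <- K) P (ik k @^-1` A k))%E.

Definition iid_uniform : Prop :=
  [/\ forall k a, measurable (ik k @^-1` [set a]),
      forall k a, P (ik k @^-1` [set a]) = (m%:R^-1)%:E
    & mutually_independent].

End Sampling.

(* Main.v *)
Require Import Defs.
From HB Require Import structures.
From mathcomp Require Import all_boot all_order all_algebra.
From mathcomp Require Import all_classical all_reals all_analysis.
From mathcomp Require Import measurable_realfun finmap ring lra.

Set Implicit Arguments.
Unset Strict Implicit.
Unset Printing Implicit Defensive.

Import Order.TTheory GRing.Theory Num.Theory.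
Import numFieldNormedType.Exports.

Local Open Scope classical_set_scope.
Local Open Scope ring_scope.

(** Write d = dual X g, h_i = supp (X i), and let G be the conjugate of g, so
    that d y = G (- \sum_i row i y) + \sum_i h_i (row i y).

    Strong convexity of g makes the supremum defining G attained, with quadratic
    decrease of the objective away from the maximizer p (conjugate_attained).
    Hence G (u + h) lies between G u + dot p h and the same quantity plus half
    the squared norm of h (conjugate_sandwich), so that p is the gradient of G
    and the smooth part of d is convex and 1-smooth in each block.

    The proximal map of h_i is given by Moreau's decomposition, w minus its
    projection on X i, and the minimum defining it grows quadratically
    (prox_supp).  Combined with smoothness, this bounds
    d y+ + |y+ - z|^2 / 2 after an update y+ of block a, for every z with d z
    finite, by d y + |y - z|^2 / 2 plus a term depending on block a only
    (rcd_step_le).  For z = y this shows that d never increases along the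
    iterates.  Summing over a and using the convexity of G, the extra terms add
    up to at most d z - d y (rcd_step_sum).  With z ranging over the solution
    set, it follows that

      V y = d y - d* + dist (y, Y* )^2 / 2

    loses on average at least (d y - d* ) / m per step, and quadratic growth
    turns this into the factor 1 - sigma / (m (sigma + 1)) (lyapunov_step).

    It remains to iterate the averaged inequality
    (expectation_trajectory_le).  The k-th iterate depends on finitely many
    sampled indices, so the underlying space is split along their values, all
    prefixes of length N having probability m^-N.

    When d y0 is infinite, or when the solution set is empty and its distance to
    y0 therefore infinite, the right-hand side of the bound is infinite. *)

(** * Euclidean structure *)

Section EuclideanTheory.
Context {R : realType} {m n : nat}.
Implicit Types (u v w x y : 'M[R]_(m, n)).

Lemma dotC u v : dot u v = dot v u.
Proof. by apply: eq_bigr => i _; apply: eq_bigr => j _; rewrite mulrC. Qed.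

Lemma dotDl u v w : dot (u + v) w = dot u w + dot v w.
Proof.
rewrite -big_split; apply: eq_bigr => i _; rewrite -big_split.
by apply: eq_bigr => j _; rewrite mxE mulrDl.
Qed.

Lemma dotZl (a : R) u w : dot (a *: u) w = a * dot u w.
Proof.
rewrite /dot mulr_sumr; apply: eq_bigr => i _; rewrite mulr_sumr.
by apply: eq_bigr => j _; rewrite mxE mulrA.
Qed.

Lemma dotNl u w : dot (- u) w = - dot u w.
Proof. by rewrite -scaleN1r dotZl mulN1r. Qed.

Lemma dotDr u v w : dot w (u + v) = dot w u + dot w v.
Proof. by rewrite dotC dotDl !(dotC w). Qed.

Lemma dotZr (a : R) u w : dot w (a *: u) = a * dot w u.
Proof. by rewrite dotC dotZl dotC. Qed.

Lemma dotNr u w : dot w (- u) = - dot w u.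
Proof. by rewrite dotC dotNl dotC. Qed.

Lemma dot0l v : dot 0 v = 0.
Proof. by rewrite -(scale0r v) dotZl mul0r. Qed.

Lemma dot_suml (I : Type) (s : seq I) (F : I -> 'M[R]_(m, n)) v :
  dot (\sum_(i <- s) F i) v = \sum_(i <- s) dot (F i) v.
Proof.
by elim/big_ind2: _ => [|_ a _ b <- <-|//]; rewrite ?dotDl ?dot0l.
Qed.

Lemma dot_sumr (I : Type) (s : seq I) (F : I -> 'M[R]_(m, n)) v :
  dot v (\sum_(i <- s) F i) = \sum_(i <- s) dot v (F i).
Proof. by rewrite dotC dot_suml; apply: eq_bigr => i _; rewrite dotC. Qed.

Lemma dotvv_ge0 u : 0 <= dot u u.
Proof. by apply: sumr_ge0 => i _; apply: sumr_ge0 => j _; rewrite -expr2 sqr_ge0. Qed.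

Lemma enorm_ge0 u : 0 <= enorm u.
Proof. exact: sqrtr_ge0. Qed.

Lemma sqr_enorm u : enorm u ^+ 2 = dot u u.
Proof. by rewrite sqr_sqrtr ?dotvv_ge0. Qed.

Lemma enormN u : enorm (- u) = enorm u.
Proof. by rewrite /enorm dotNl dotNr opprK. Qed.

Lemma enorm0_eq0 u : enorm u ^+ 2 <= 0 -> u = 0.
Proof.
rewrite sqr_enorm => u0; apply/matrixP => i j; rewrite mxE.
have row_ge0 k : 0 <= \sum_(l < n) u k l * u k l.
  by apply: sumr_ge0 => l _; rewrite -expr2 sqr_ge0.
have /eqP := le_anti (introT andP (conj u0 (dotvv_ge0 u))).
rewrite psumr_eq0 // => /allP/(_ i (mem_index_enum _))/=.
rewrite psumr_eq0 => [|l _]; last by rewrite -expr2 sqr_ge0.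
move=> /allP/(_ j (mem_index_enum _))/=.
by rewrite -expr2 sqrf_eq0 => /eqP.
Qed.

Lemma enormZ (a : R) u : enorm (a *: u) = `|a| * enorm u.
Proof.
by rewrite /enorm dotZl dotZr mulrA -expr2 sqrtrM ?sqr_ge0// sqrtr_sqr.
Qed.

Lemma coord_le_enorm u i j : `|u i j| <= enorm u.
Proof.
rewrite -sqrtr_sqr ler_sqrt ?dotvv_ge0// /dot (bigD1 i)//= (bigD1 j)//=.
rewrite expr2 -addrA lerDl addr_ge0//.
  by apply: sumr_ge0 => k _; rewrite -expr2 sqr_ge0.
by apply: sumr_ge0 => k _; apply: sumr_ge0 => l _; rewrite -expr2 sqr_ge0.
Qed.

Lemma continuous_dotl u : continuous (fun x => dot u x).
Proof.
rewrite /dot; apply: continuous_big => [|i _]; first exact: add_continuous.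
apply: continuous_big => [|j _ x]; first exact: add_continuous.
by apply: continuousM; [exact: cst_continuous|exact: coord_continuous].
Qed.

Lemma continuous_dotvv : continuous (fun x => dot x x).
Proof.
rewrite /dot; apply: continuous_big => [|i _]; first exact: add_continuous.
apply: continuous_big => [|j _ x]; first exact: add_continuous.
by apply: continuousM; apply: coord_continuous.
Qed.

End EuclideanTheory.

Lemma dot_rowE {R : realType} (m n : nat) (u v : 'M[R]_(m, n)) :
  dot u v = \sum_(i < m) dot (row i u) (row i v).
Proof.
apply: eq_bigr => i _; rewrite /dot big_ord1; apply: eq_bigr => j _.
by rewrite !mxE.
Qed.

(** Turns identities and inequalities between squared norms into linear ones in
    the inner products of the vectors involved, up to the symmetry of dot. *)
Definition dotE {R : realType} {m n : nat} :=
  (@sqr_enorm R m n, @dotDl R m n, @dotDr R m n, @dotNl R m n, @dotNr R m n,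
   @dotZl R m n, @dotZr R m n).

(** * Strongly convex minimization *)

Section StronglyConvex.
Context {R : realType} {n : nat}.
Implicit Types (C : set 'rV[R]_n) (f : 'rV[R]_n -> R).

Lemma convex_set_segment C :
    convex_set (C : set (convex_lmodType 'rV[R]_n)) ->
  forall x y (t : R), C x -> C y -> 0 <= t <= 1 -> C (t *: x + (1 - t) *: y).
Proof.
move=> cvxC x y t Cx Cy /andP[t0 t1].
exact: set_mem (cvxC x y (Itv01 t0 t1) (mem_set Cx) (mem_set Cy)).
Qed.

Lemma compact_cube (a : 'rV[R]_n) (r : R) :
  compact [set x : 'rV[R]_n | forall j, `|x 0 j - a 0 j| <= r].
Proof.
have := @rV_compact _ n (fun j => `[a 0 j - r, a 0 j + r]%classic)
  (fun j => @segment_compact _ _ _).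
congr compact; apply/seteqP; split => x /= h j; have := h j;
  by rewrite /= in_itv/= ler_distl.
Qed.

(** Strong convexity along the segment from a to x makes f larger than f a as
    soon as x is far from a, because f is bounded below near a.  So the
    minimum over C is attained in a compact cube around a. *)
Lemma strongly_convex_minimizer f C a :
    strongly_convex 1 f -> continuous f -> closed C -> C a ->
  exists2 p, C p & forall x, C x -> f p <= f x.
Proof.
move=> scf cf clC Ca.
pose cube (r : R) := [set x : 'rV[R]_n | forall j, `|x 0 j - a 0 j| <= r].
have cube_a r : 0 <= r -> cube r a.
  by move=> r0 j; rewrite subrr normr0.
have [z0 _ z0min] : exists2 c, c \in cube 1 & forall x, x \in cube 1 -> f c <= f x.
  apply: EVT_min_rV; first by exists a; exact: cube_a.
    exact: compact_cube.
  exact: continuous_subspaceT.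
have z0a : f z0 <= f a by apply: z0min; apply: mem_set; exact: cube_a.
(* A point x at distance e > 1 of a with f x <= f a satisfies e <= r: the point
   of the segment from a to x at distance 1 of a lies in the unit cube, where
   f >= f z0, while strong convexity bounds f there by f a - (e - 1) / 2. *)
pose r := 1 + 2 * (f a - f z0).
have [p pCr pmin] : exists2 c, c \in C `&` cube r &
    forall x, x \in C `&` cube r -> f c <= f x.
  apply: EVT_min_rV.
  - by exists a; split => //; apply: cube_a; rewrite /r; lra.
  - rewrite setIC; apply: compact_closedI => //; exact: compact_cube.
  - exact: continuous_subspaceT.
exists p; first by have [] := set_mem pCr.
move=> x Cx; have [fax|fxa] := leP (f a) (f x).
  apply: le_trans fax; apply: pmin; apply: mem_set; split => //.
  by apply: cube_a; rewrite /r; lra.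
apply: pmin; apply: mem_set; split => // j.
have -> : x 0 j - a 0 j = (x - a) 0 j by rewrite !mxE.
apply: le_trans (coord_le_enorm _ _ _) _.
have [e1|e1] := leP (enorm (x - a)) 1; first by rewrite /r; lra.
set e := enorm (x - a) in e1 *.
have e0 : 0 < e by lra.
have t01 : 0 <= e^-1 <= 1 by rewrite invr_ge0 (ltW e0)/= invf_le1// ltW.
have fz : f z0 <= f (e^-1 *: x + (1 - e^-1) *: a).
  apply: z0min; apply: mem_set => k.
  have -> : (e^-1 *: x + (1 - e^-1) *: a) 0 k - a 0 k = (e^-1 *: (x - a)) 0 k.
    by rewrite !mxE; ring.
  apply: le_trans (coord_le_enorm _ _ _) _.
  by rewrite enormZ ger0_norm ?invr_ge0 ?(ltW e0)// mulVf// lt0r_neq0.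
have := le_trans fz (scf x a _ t01); rewrite -/e.
have -> : 1 / 2 * e^-1 * (1 - e^-1) * e ^+ 2 = (e - 1) / 2.
  by field; exact: lt0r_neq0.
have : e^-1 * f x <= e^-1 * f a by rewrite ler_wpM2l ?invr_ge0 ?(ltW e0) ?(ltW fxa).
rewrite /r; lra.
Qed.

(** Comparing the minimizer p with the points of the segment from p to x that
    are close to p turns strong convexity into quadratic growth. *)
Lemma strongly_convex_growth f C a :
    strongly_convex 1 f -> continuous f -> closed C ->
    convex_set (C : set (convex_lmodType 'rV[R]_n)) -> C a ->
  exists2 p, C p & forall x, C x -> f p + 2^-1 * enorm (x - p) ^+ 2 <= f x.
Proof.
move=> scf cf clC cvxC Ca.
have [p Cp pmin] := strongly_convex_minimizer scf cf clC Ca.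
exists p => // x Cx; apply/ler_addgt0Pr => e e0.
set q := enorm (x - p) ^+ 2; have q0 : 0 <= q by rewrite sqr_ge0.
(* The weight is positive and small enough for t * q <= e. *)
pose t := e / (e + q).
have eq0 : 0 < e + q by rewrite ltr_wpDr.
have t0 : 0 < t by rewrite divr_gt0.
have t1 : t <= 1 by rewrite ler_pdivrMr// mul1r lerDl.
have t01 : 0 <= t <= 1 by rewrite (ltW t0).
have := le_trans (pmin _ (convex_set_segment cvxC Cx Cp t01)) (scf x p t t01).
rewrite -/q => h.
have {}h : t * (f p + 2^-1 * (1 - t) * q) <= t * f x by lra.
have tq : t * q <= e.
  by rewrite mulrAC ler_pdivrMr// ler_wpM2l ?(ltW e0)// lerDr (ltW e0).
move: h; rewrite ler_pM2l//; lra.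
Qed.

End StronglyConvex.

(** * Conjugates of strongly convex functions *)

Section Conjugate.
Context {R : realType} {n : nat} (g : 'rV[R]_n -> R).
Hypotheses (scg : strongly_convex 1 g) (cg : continuous g).

Let G (u : 'rV[R]_n) : R := fine (conjugate g u).

(** This is strongly_convex_growth for g - dot u, which is again 1-strongly
    convex. *)
Lemma conjugate_attained u : exists p,
  conjugate g u = (dot u p - g p)%:E /\
  forall x, dot u x - g x <= dot u p - g p - 2^-1 * enorm (x - p) ^+ 2.
Proof.
have scgu : strongly_convex 1 (fun x => g x - dot u x).
  by move=> x y t t01; have := scg x y t01; rewrite !dotDr !dotZr; lra.
have cgu : continuous (fun x => g x - dot u x).
  by move=> x; apply: continuousB; [exact: cg|exact: continuous_dotl].
have cvxT : convex_set (setT : set (convex_lmodType 'rV[R]_n)).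
  by move=> x y t _ _; exact: mem_set.
have [p _ growth] :=
  strongly_convex_growth scgu cgu closedT cvxT (I : setT (0 : 'rV[R]_n)).
have gr x : dot u x - g x <= dot u p - g p - 2^-1 * enorm (x - p) ^+ 2.
  by have := growth x Logic.I; lra.
exists p; split => //; apply/eqP; rewrite eq_le; apply/andP; split.
  apply: ge_ereal_sup => _ [x _ <-]; rewrite lee_fin.
  by have := gr x; have := sqr_ge0 (enorm (x - p)); lra.
by apply: ereal_sup_ubound; exists p.
Qed.

Lemma conjugate_fin u : conjugate g u = (G u)%:E.
Proof. by have [p [gp _]] := conjugate_attained u; rewrite /G gp. Qed.

(** The lower bound is the subgradient inequality at the maximizer p; for the
    upper bound, dot h (x - p) is absorbed by the quadratic decrease of the
    objective. *)
Lemma conjugate_sandwich u : exists p, forall h,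
  G u + dot p h <= G (u + h) <= G u + dot p h + 2^-1 * enorm h ^+ 2.
Proof.
have [p [gp growth]] := conjugate_attained u; exists p => h; rewrite /G gp/=.
rewrite -!lee_fin -conjugate_fin; apply/andP; split.
  apply: ereal_sup_ubound; exists p => //; congr EFin.
  by rewrite dotDl (dotC h); ring.
apply: ge_ereal_sup => _ [x _ <-]; rewrite lee_fin.
have := growth x; have := sqr_ge0 (enorm (x - p - h)).
rewrite !dotE (dotC x h) (dotC p h) (dotC x p); lra.
Qed.

End Conjugate.

(** A quadratic sandwich around an affine function fixes the directional
    derivatives, the difference quotients being off by at most half of
    |t| |e_j|^2. *)
Lemma grad_sandwich {R : realType} {n : nat} (f : 'rV[R]_n -> R) u p :
    (forall h, f u + dot p h <= f (u + h)
               <= f u + dot p h + 2^-1 * enorm h ^+ 2) ->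
  grad f u = p.
Proof.
move=> fp; apply/rowP => j; rewrite mxE; set e := delta_mx 0 j.
have -> : p 0 j = dot p e.
  rewrite /dot big_ord1 (bigD1 j)//= big1 => [|k kj].
    by rewrite !mxE !eqxx mulr1 addr0.
  by rewrite !mxE (negPf kj) andbF mulr0.
apply: cvg_lim => //; apply/cvgrPdist_le => /= eps eps0.
pose q := enorm e ^+ 2; have q0 : 0 <= q by rewrite sqr_ge0.
near=> t.
have t0 : t != 0 by near: t; exact: nbhs_dnbhs_neq.
have tq : `|t| * q <= eps.
  have : `|t| <= eps / (q + 1).
    by near: t; apply: dnbhs0_le; rewrite divr_gt0// ltr_wpDl.
  by rewrite ler_pdivlMr ?ltr_wpDl//; have := normr_ge0 t; lra.
have := fp (t *: e); rewrite dotZr enormZ exprMn -/q (addrC u) => /andP[lo hi].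
have -> : dot p e - t^-1 *: (f (t *: e + u) - f u) =
   t^-1 * (t * dot p e - (f (t *: e + u) - f u)).
  by rewrite /GRing.scale/=; field.
rewrite normrM normfV ler_pdivrMl ?normr_gt0// ler_norml.
have : `|t| * (`|t| * q) <= `|t| * eps by rewrite ler_wpM2l.
have : 0 <= `|t| * eps by rewrite mulr_ge0// ltW.
move: lo hi; rewrite expr2 -!mulrA; lra.
Unshelve. all: by end_near. Qed.

(** The lower bound expresses the convexity of the conjugate and the upper bound
    its 1-smoothness; rcd_step_sum uses the former and rcd_step_le the latter. *)
Lemma conjugate_smooth {R : realType} {n : nat} (g : 'rV[R]_n -> R) :
    strongly_convex 1 g -> continuous g ->
  let G u := fine (conjugate g u) in forall u h,
  G u + dot (grad G u) h <= G (u + h)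
    <= G u + dot (grad G u) h + 2^-1 * enorm h ^+ 2.
Proof.
move=> scg cg G u; have [p sandwich] := conjugate_sandwich scg cg u.
by rewrite (grad_sandwich sandwich).
Qed.

(** * The proximal map of a support function *)

Section ProxSupport.
Context {R : realType} {n : nat}.
Variable C : set 'rV[R]_n.
Hypotheses (C_closed : closed C)
  (C_convex : convex_set (C : set (convex_lmodType 'rV[R]_n)))
  (C_nonempty : C !=set0).

Lemma projection w : exists2 q, C q &
  forall x, C x -> dot (w - q) (x - q) <= 0.
Proof.
have [a Ca] := C_nonempty.
pose f (x : 'rV[R]_n) := 2^-1 * enorm (x - w) ^+ 2.
have scf : strongly_convex 1 f.
  move=> x y t t01; rewrite /f !dotE (dotC y x) (dotC w x) (dotC w y).
  by rewrite le_eqVlt; apply/orP; left; apply/eqP; field.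
have cf : continuous f.
  have -> : f = (fun x => 2^-1 * dot (x - w) (x - w)).
    by apply/funext => x; rewrite /f sqr_enorm.
  move=> x; apply: (@continuousM R 'rV[R]_n (fun=> 2^-1) (fun x => dot (x - w) (x - w))).
    exact: cst_continuous.
  apply: (@continuous_comp 'rV[R]_n 'rV[R]_n R (fun x => x - w) (fun x => dot x x)).
    by apply: continuousB; [exact: cvg_id|exact: cst_continuous].
  exact: continuous_dotvv.
have [q Cq growth] := strongly_convex_growth scf cf C_closed C_convex Ca.
exists q => // x /growth; rewrite /f !dotE (dotC x w) (dotC q w) (dotC x q); lra.
Qed.

Lemma supp_gt_ninfty v : (-oo < supp C v)%E.
Proof.
have [a Ca] := C_nonempty; apply: (@lt_le_trans _ _ (dot v a)%:E).
  exact: ltNyr.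
by apply: ereal_sup_ubound; exists a.
Qed.

(** Moreau's decomposition: the proximal point is w - q for the projection q of
    w on C.  Indeed supp C (w - q) = dot (w - q) q, while supp C v >= dot v q
    everywhere, and the objective with dot v q in place of supp C v is an exact
    quadratic with minimizer w - q. *)
Lemma prox_supp w : let p := prox (supp C) w in
  supp C p \is a fin_num /\ forall v,
  ((2^-1 * enorm (p - w) ^+ 2 + 2^-1 * enorm (v - p) ^+ 2)%:E + supp C p
    <= (2^-1 * enorm (v - w) ^+ 2)%:E + supp C v)%E.
Proof.
have [q Cq qP] := projection w.
have supp_p : supp C (w - q) = (dot (w - q) q)%:E.
  apply/eqP; rewrite eq_le; apply/andP; split.
    apply: ge_ereal_sup => _ [x Cx <-]; rewrite lee_fin.
    by have := qP x Cx; rewrite dotDr dotNr; lra.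
  by apply: ereal_sup_ubound; exists q.
have growth v : ((2^-1 * enorm (w - q - w) ^+ 2
    + 2^-1 * enorm (v - (w - q)) ^+ 2)%:E + supp C (w - q)
    <= (2^-1 * enorm (v - w) ^+ 2)%:E + supp C v)%E.
  apply: (@le_trans _ _ ((2^-1 * enorm (v - w) ^+ 2)%:E + (dot v q)%:E)%E).
    rewrite supp_p -!EFinD lee_fin !dotE (dotC v w) (dotC q w) (dotC q v); lra.
  by apply: leeD2l; apply: ereal_sup_ubound; exists q.
suff -> : prox (supp C) w = w - q by split; [rewrite supp_p|].

have p_min : argmin (fun z => (2^-1 * enorm (z - w) ^+ 2)%:E + supp C z)%E (w - q).
  move=> v; apply: le_trans (growth v); apply: leeD2r; rewrite lee_fin.
  by have := sqr_ge0 (enorm (v - (w - q))); lra.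
have := xgetPex 0 (ex_intro _ _ p_min) (w - q); rewrite -/(prox (supp C) w).
move=> /(le_trans (growth _)); rewrite supp_p -!EFinD lee_fin => h.
apply/eqP; rewrite -subr_eq0; apply/eqP/enorm0_eq0.
by move: h; lra.
Qed.

End ProxSupport.

(** * One step of the algorithm *)

Section RCDStep.
Context {R : realType} {m n : nat}.
Variables (X : 'I_m -> set 'rV[R]_n) (g : 'rV[R]_n -> R).
Hypotheses (X_closed : forall i, closed (X i))
  (X_convex : forall i, convex_set (X i : set (convex_lmodType 'rV[R]_n)))
  (X_common : exists xbar, forall i, X i xbar)
  (scg : strongly_convex 1 g) (cg : continuous g).
Implicit Types y z : 'M[R]_(m, n).

Let X_nonempty i : X i !=set0.
Proof. by have [x Xx] := X_common; exists x. Qed.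

Let G u := fine (conjugate g u).
Let H i v := fine (supp (X i) v).
Let msum y := - \sum_(j < m) row j y.

Definition dual_dom y := forall i, supp (X i) (row i y) \is a fin_num.

Definition dualR y := fine (dual X g y).

Lemma dual_domE y : dual_dom y ->
  dual X g y = (G (msum y) + \sum_(i < m) H i (row i y))%:E.
Proof.
move=> dom_y; rewrite /dual /dual_smooth conjugate_fin// EFinD -sumEFin.
by congr (_ + _)%E; apply: eq_bigr => i _; rewrite fineK.
Qed.

Lemma dual_fin y : dual_dom y -> dual X g y = (dualR y)%:E.
Proof. by move=> dom_y; rewrite /dualR dual_domE. Qed.

Lemma dual_dom_lty y : (dual X g y < +oo)%E -> dual_dom y.
Proof.
move=> d_lty i.
have suppNy j : true -> supp (X j) (row j y) != -oo%E.
  by rewrite gt_eqF ?supp_gt_ninfty.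
rewrite fin_numE suppNy//=; apply: contraTN d_lty => /eqP Hi.
rewrite -leNgt /dual /dual_smooth conjugate_fin//.
suff -> : (\sum_(j < m) supp (X j) (row j y) = +oo)%E by [].
by apply/esum_eqyP => //; exists i; split=> //; exact: mem_index_enum.
Qed.

(** Weak duality: at a common point x the terms dot (row i y) x cancel. *)
Lemma dual_opt_gt_ninfty : (-oo < dual_opt X g)%E.
Proof.
have [x Xx] := X_common; apply: (@lt_le_trans _ _ (- g x)%:E).
  exact: ltNyr.
apply: le_ereal_inf_tmp => _ [y _ <-].
apply: (@le_trans _ _
    ((dot (msum y) x - g x)%:E + \sum_(i < m) (dot (row i y) x)%:E)%E).
  by rewrite sumEFin -EFinD lee_fin dotNl dot_suml; lra.
apply: leeD; first by apply: ereal_sup_ubound; exists x.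
by apply: lee_sum => i _; apply: ereal_sup_ubound; exists x.
Qed.

Lemma dual0_lty : (dual X g 0 < +oo)%E.
Proof.
rewrite /dual /dual_smooth conjugate_fin//.
suff -> : (\sum_(i < m) supp (X i) (row i 0) = 0)%E by rewrite adde0 ltry.
apply: big1 => i _; have dot0 x : dot (row i (0 : 'M[R]_(m, n))) x = 0.
  by rewrite row0 dot0l.
have [x Xx] := X_nonempty i; apply/eqP; rewrite eq_le; apply/andP; split.
  by apply: ge_ereal_sup => _ [z _ <-]; rewrite dot0.
by apply: ereal_sup_ubound; exists x; rewrite ?dot0.
Qed.

Lemma dual_opt_fin : dual_opt X g \is a fin_num.
Proof.
rewrite fin_numElt dual_opt_gt_ninfty/=; apply: le_lt_trans dual0_lty.
by apply: ereal_inf_lbound; exists 0.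
Qed.

Lemma dual_opt_le y : (dual_opt X g <= dual X g y)%E.
Proof. by apply: ereal_inf_lbound; exists y. Qed.

Lemma dual_sol_dom z : dual_sol X g z -> dual_dom z.
Proof.
by move=> zY; apply: dual_dom_lty; apply: le_lt_trans (zY 0) dual0_lty.
Qed.

Lemma dual_sol_opt z : dual_sol X g z -> dual_opt X g = (dualR z)%:E.
Proof.
move=> zY; rewrite -dual_fin; last exact: dual_sol_dom.
apply/eqP; rewrite eq_le dual_opt_le/=.
by apply: le_ereal_inf_tmp => _ [y _ <-]; exact: zY.
Qed.

Lemma rcd_step_dom a y : dual_dom y -> dual_dom (rcd_step X g a y).
Proof.
move=> dom_y i; rewrite rowK; case: eqP => [->|_]; last exact: dom_y.
by have [] := prox_supp (@X_closed a) (@X_convex a) (X_nonempty a)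
  (row a y - dual_partial_grad g a y).
Qed.

Lemma msum_rcd_step a y : msum (rcd_step X g a y) =
  msum y + (row a y - row a (rcd_step X g a y)).
Proof.
rewrite /msum (bigD1 a)//= [in RHS](bigD1 a)//=.
under eq_bigr => j ja do rewrite rowK (negPf ja).
by rewrite !opprD addrACA addNr add0r addrC.
Qed.

(** Only block a contributes to the change of the squared distance to z. *)
Lemma enorm_rcd_step a y z : enorm (rcd_step X g a y - z) ^+ 2 =
  enorm (y - z) ^+ 2 - enorm (row a (y - z)) ^+ 2
  + enorm (row a (rcd_step X g a y - z)) ^+ 2.
Proof.
rewrite !sqr_enorm !(@dot_rowE _ m n) [in LHS](bigD1 a)//= [in RHS](bigD1 a)//=.
rewrite [in LHS](eq_bigr (fun i => dot (row i (y - z)) (row i (y - z)))).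
  by ring.
by move=> i ia; rewrite !linearB/= rowK (negPf ia).
Qed.

(** The proximal subproblem on block a minimizes a 1-strongly convex model of
    the dual function which dominates the dual function on that block and is
    exact at y: comparing its minimizer with row a z gives the bound.  The
    terms are arranged so that summing over a is immediate. *)
Lemma rcd_step_le a y z : dual_dom y -> dual_dom z ->
  dualR (rcd_step X g a y) + 2^-1 * enorm (rcd_step X g a y - z) ^+ 2 <=
  dualR y + 2^-1 * enorm (y - z) ^+ 2
  + (H a (row a z) - H a (row a y) - dot (grad G (msum y)) (row a z - row a y)).
Proof.
move=> dom_y dom_z; have dom_y' := rcd_step_dom a dom_y.
rewrite enorm_rcd_step /dualR !dual_domE//=.
set y' := rcd_step X g a y in dom_y' *.
have -> : \sum_(i < m) H i (row i y') =
    \sum_(i < m) H i (row i y) - H a (row a y) + H a (row a y').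
  rewrite (bigD1 a)//= [in RHS](bigD1 a)//=.
  rewrite [in LHS](eq_bigr (fun i => H i (row i y))); first by ring.
  by move=> i ia; rewrite rowK (negPf ia).
rewrite /y' msum_rcd_step -/y'.
have smooth : G (msum y + (row a y - row a y')) <=
    G (msum y) + dot (grad G (msum y)) (row a y - row a y')
    + 2^-1 * enorm (row a y - row a y') ^+ 2.
  by have /andP[] := conjugate_smooth scg cg (msum y) (row a y - row a y').
have [_ /(_ (row a z))] := prox_supp (@X_closed a) (@X_convex a)
  (X_nonempty a) (row a y - dual_partial_grad g a y).
have <- : row a y' = prox (supp (X a)) (row a y - dual_partial_grad g a y).
  by rewrite rowK eqxx.
rewrite -[supp _ (row a y')]fineK; last exact: dom_y'.
rewrite -[supp _ (row a z)]fineK; last exact: dom_z.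
rewrite -!EFinD lee_fin /dual_partial_grad -/G -/(msum y) opprK.
rewrite -/(H a (row a z)) -/(H a (row a y')).
move: smooth.
set p := row a y'; set q := row a y; set v := row a z; set d := grad G (msum y).
have -> : row a (y - z) = q - v by rewrite linearB.
have -> : row a (y' - z) = p - v by rewrite linearB.
rewrite !dotE (dotC p v) (dotC p q) (dotC p d) (dotC q v) (dotC v d) (dotC q d).
lra.
Qed.

Lemma rcd_step_descent a y : dual_dom y ->
  dualR (rcd_step X g a y) <= dualR y.
Proof.
move=> dom_y; have := rcd_step_le a dom_y dom_y.
have := sqr_ge0 (enorm (rcd_step X g a y - y)).
rewrite !subrr !sqr_enorm (dotC (grad _ _)) !dot0l; lra.
Qed.

(** Summing over the blocks, the linear terms add up to the subgradient
    inequality for the smooth part between y and z. *)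
Lemma rcd_step_sum y z : dual_dom y -> dual_dom z ->
  \sum_(a < m) (dualR (rcd_step X g a y)
                + 2^-1 * enorm (rcd_step X g a y - z) ^+ 2) <=
  m%:R * (dualR y + 2^-1 * enorm (y - z) ^+ 2) - (dualR y - dualR z).
Proof.
move=> dom_y dom_z.
apply: le_trans (ler_sum _ (fun a _ => rcd_step_le a dom_y dom_z)) _.
rewrite big_split/= sumr_const card_ord -mulr_natl.
rewrite !sumrB -dot_sumr/=.
have /andP[+ _] := conjugate_smooth scg cg (msum y) (msum z - msum y).
have -> : msum y + (msum z - msum y) = msum z by rewrite addrC subrK.
rewrite -/(G (msum z)) -/(G (msum y)).
have -> : msum z - msum y = - \sum_(a < m) (row a z - row a y).
  by rewrite sumrB /msum opprB opprK addrC.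
rewrite dotNr dot_sumr /dualR !dual_domE//=. lra.
Qed.
End RCDStep.

(** * Contraction of the Lyapunov function *)

Section Distance.
Context {R : realType} {m n : nat}.
Variables (y : 'M[R]_(m, n)) (Y : set 'M[R]_(m, n)).
Hypothesis Y_nonempty : Y !=set0.

Lemma dist_ge0 : (0 <= dist y Y)%E.
Proof. by apply: le_ereal_inf_tmp => _ [z _ <-]; rewrite lee_fin enorm_ge0. Qed.

Lemma dist_fin : dist y Y = (fine (dist y Y))%:E.
Proof.
have [z Yz] := Y_nonempty; rewrite fineK// ge0_fin_numE ?dist_ge0//.
by apply: le_lt_trans (ltry (enorm (z - y))); apply: ereal_inf_lbound; exists z.
Qed.

Lemma fine_dist_ge0 : 0 <= fine (dist y Y).
Proof. by rewrite -lee_fin -dist_fin dist_ge0. Qed.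

Lemma dist_sqr_le z : Y z -> fine (dist y Y) ^+ 2 <= enorm (y - z) ^+ 2.
Proof.
move=> Yz; rewrite ler_sqr ?nnegrE ?enorm_ge0 ?fine_dist_ge0//.
by rewrite -lee_fin -dist_fin -enormN opprB; apply: ereal_inf_lbound; exists z.
Qed.

(** A bound valid for every point of Y passes to the infimum after taking square
    roots, so the one-step inequality can be used with the distance in place of
    a nearest point. *)
Lemma le_dist_sqr (c : R) :
  (forall z, Y z -> c <= enorm (y - z) ^+ 2) -> c <= fine (dist y Y) ^+ 2.
Proof.
move=> cY; have [c0|c0] := ltP c 0; first by rewrite (le_trans (ltW c0))// sqr_ge0.
rewrite -[leLHS]sqr_sqrtr// ler_sqr ?nnegrE ?sqrtr_ge0 ?fine_dist_ge0//.
rewrite -lee_fin -dist_fin; apply: le_ereal_inf_tmp => _ [z Yz <-].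
rewrite lee_fin -(ger0_norm (enorm_ge0 _)) -sqrtr_sqr ler_sqrt ?sqr_ge0//.
by rewrite -enormN opprB; exact: cY.
Qed.

End Distance.

Section Lyapunov.
Context {R : realType} {m n : nat}.
Variables (X : 'I_m -> set 'rV[R]_n) (g : 'rV[R]_n -> R).
Hypotheses (m_gt0 : (0 < m)%N) (X_closed : forall i, closed (X i))
  (X_convex : forall i, convex_set (X i : set (convex_lmodType 'rV[R]_n)))
  (X_common : exists xbar, forall i, X i xbar)
  (scg : strongly_convex 1 g) (cg : continuous g)
  (Y_nonempty : dual_sol X g !=set0).

Definition lyapunov (y : 'M[R]_(m, n)) : R :=
  dualR X g y - fine (dual_opt X g)
  + 2^-1 * fine (dist y (dual_sol X g)) ^+ 2.

(** Averaging over the blocks removes a fraction 1/m of the dual gap from the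
    Lyapunov function.  By quadratic growth the gap is itself at least the
    fraction sigma / (sigma + 1) of the Lyapunov function: it is the convex
    combination of two copies of the gap, with weights sigma / (sigma + 1) and
    1 / (sigma + 1), the second copy being bounded by the distance term. *)
Lemma lyapunov_step (sigma : R) y : 0 < sigma -> dual_dom X y ->
    sigma / 2 * fine (dist y (dual_sol X g)) ^+ 2
      <= dualR X g y - fine (dual_opt X g) ->
  \sum_(a < m) lyapunov (rcd_step X g a y) <=
  m%:R * ((1 - sigma / (m%:R * (sigma + 1))) * lyapunov y).
Proof.
move=> sigma_gt0 dom_y growth.
have mR : 0 < m%:R :> R by rewrite ltr0n.
set d := fine (dual_opt X g) in growth *.
set s := \sum_(a < m) _.
have s_le z : dual_sol X g z ->
    s <= m%:R * (dualR X g y - d + 2^-1 * enorm (y - z) ^+ 2) - (dualR X g y - d).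
  move=> zY; have dom_z := dual_sol_dom X_common scg cg zY.
  have dz : d = dualR X g z by rewrite /d (dual_sol_opt X_common scg cg zY).
  have := rcd_step_sum X_closed X_convex X_common scg cg dom_y dom_z.
  rewrite big_split/= => sum_le.
  have : s <= \sum_(a < m) (dualR X g (rcd_step X g a y) - d
      + 2^-1 * enorm (rcd_step X g a y - z) ^+ 2).
    apply: ler_sum => a _; rewrite /lyapunov -/d lerD2l ler_wpM2l//.
    exact: dist_sqr_le.
  rewrite 2!big_split/= sumr_const card_ord -[_ *+ m]mulr_natl -dz in sum_le *.
  lra.
have : (s + (dualR X g y - d) - m%:R * (dualR X g y - d)) / (m%:R / 2)
    <= fine (dist y (dual_sol X g)) ^+ 2.
  apply: le_dist_sqr => // z /s_le h.
  by rewrite ler_pdivrMr ?divr_gt0//; lra.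
rewrite ler_pdivrMr ?divr_gt0// => s_le'.
have -> : m%:R * ((1 - sigma / (m%:R * (sigma + 1))) * lyapunov y) =
    m%:R * lyapunov y - sigma / (sigma + 1) * lyapunov y.
  by field; rewrite !gt_eqF//; lra.
have : sigma / (sigma + 1) * lyapunov y <= dualR X g y - d.
  rewrite mulrAC ler_pdivrMr; last by lra.
  by rewrite /lyapunov -/d; lra.
rewrite /lyapunov -/d; lra.
Qed.

End Lyapunov.

(** * Expectation along a randomly driven trajectory *)

Section RandomTrajectory.
Context {R : realType} {dis : measure_display} {Omega : measurableType dis}.
Variables (P : probability Omega R) (m : nat) (ik : nat -> Omega -> 'I_m).
Hypothesis ik_sampling : iid_uniform P ik.
Variables (T : Type) (step : 'I_m -> T -> T).

(** The recursion that defines rcd, for an arbitrary step: the argument below only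
    uses a function V that decreases on average. *)
Fixpoint trajectory (y : T) (s : nat -> 'I_m) (k : nat) : T :=
  if k is k'.+1 then step (s k') (trajectory y s k') else y.

Lemma trajectory_shift y (w : Omega) N k :
  trajectory y (fun j => ik (N + j)%N w) k.+1 =
  trajectory (step (ik N w) y) (fun j => ik (N.+1 + j)%N w) k.
Proof.
elim: k => [|k IH]; first by rewrite /= addn0.
by rewrite [LHS]/= -[step (ik (N + k)%N w) _]/(trajectory y _ k.+1) IH /= addnS.
Qed.

Definition history (N : nat) (s : nat -> 'I_m) : set Omega :=
  \bigcap_(j < N) (ik j @^-1` [set s j]).

Lemma measurable_history N s : measurable (history N s).
Proof.
have [mik _ _] := ik_sampling.
by apply: bigcap_measurableType => j _; exact: mik.
Qed.

Lemma prob_history N s : P (history N s) = (m%:R^-1 ^+ N)%:E.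
Proof.
have [_ Pik indep] := ik_sampling.
rewrite /history (_ : `I_N = [set` [fset j | j in iota 0 N]%fset]); last first.
  by apply/seteqP; split => j; rewrite /= !inE/= mem_iota add0n.
rewrite indep; under eq_bigr do rewrite Pik.
rewrite (perm_big (iota 0 N)); last first.
  apply: uniq_perm; rewrite ?iota_uniq ?fset_uniq// => j.
  by rewrite !inE.
by rewrite prodEFin big_const_seq count_predT size_iota iter_mulr_1.
Qed.

(** Index N gets the value a, and so do the later ones, which history N.+1 does
    not read. *)
Definition extend (N : nat) (s : nat -> 'I_m) (a : 'I_m) : nat -> 'I_m :=
  fun j => if (j < N)%N then s j else a.

Lemma history_extend N s :
  history N s = \big[setU/set0]_(a < m) history N.+1 (extend N s a).
Proof.
rewrite -bigcup_seq; apply/seteqP; split => w.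
  move=> hw; exists (ik N w); first by rewrite /= mem_index_enum.
  move=> j /=; rewrite /extend ltnS leq_eqVlt => /predU1P[->|jN].
    by rewrite ltnn.
  by rewrite jN; exact: hw.
move=> [a _ hw] j /= jN; have := hw j (ltnW jN).
by rewrite /= /extend jN.
Qed.

Lemma trivIset_history N s :
  trivIset setT (fun a => history N.+1 (extend N s a)).
Proof.
move=> a b _ _ [w [wa wb]].
have := wa N (ltnSn N); have := wb N (ltnSn N).
by rewrite /= /extend ltnn => -> ->.
Qed.

Lemma measurable_trajectory (Q : set T) y N k :
  measurable [set w | Q (trajectory y (fun j => ik (N + j)%N w) k)].
Proof.
have [mik _ _] := ik_sampling.
elim: k y N => [|k IH] y N.
  have [Qy|nQy] := pselect (Q y).
    by rewrite [X in measurable X](_ : _ = setT)//; apply/seteqP; split.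
  by rewrite [X in measurable X](_ : _ = set0)//; apply/seteqP; split.
rewrite [X in measurable X](_ : _ = \bigcup_(a in [set: 'I_m])
  (ik N @^-1` [set a] `&`
   [set w | Q (trajectory (step a y) (fun j => ik (N.+1 + j)%N w) k)])).
  apply: fin_bigcup_measurable => // a _.
  by apply: measurableI; [exact: mik|exact: IH].
apply/seteqP; split => w.
  by rewrite /mkset trajectory_shift; exists (ik N w).
by move=> [a _ [/= <-]]; rewrite -trajectory_shift.
Qed.

Variables (phi : T -> \bar R) (V : T -> R) (S : T -> Prop) (rho : R).
Hypotheses (m_gt0 : (0 < m)%N) (rho_ge0 : 0 <= rho)
  (phi_ge0 : forall y, (0 <= phi y)%E)
  (S_step : forall a y, S y -> S (step a y))
  (phi_le : forall y, S y -> (phi y <= (V y)%:E)%E)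
  (V_step : forall y, S y ->
     \sum_(a < m) V (step a y) <= m%:R * (rho * V y)).

(** Conditioning on the first index rather than on the last one keeps the
    induction on a plain one-step inequality for V: the trajectory of length
    k.+1 started at y is the one of length k started at step a y. *)
Lemma integral_trajectory_le k y N s : S y ->
  (\int[P]_(w in history N s) phi (trajectory y (fun j => ik (N + j)%N w) k)
   <= (m%:R^-1 ^+ N * (rho ^+ k * V y))%:E)%E.
Proof.
elim: k y N s => [|k IH] y N s Sy /=.
  have phi_fin : phi y = (fine (phi y))%:E.
    rewrite fineK// ge0_fin_numE//; apply: le_lt_trans (phi_le Sy) _.
    exact: ltry.
  rewrite phi_fin integral_cst; last exact: measurable_history.
  rewrite [X in (_ * X)%E](_ : _ = (m%:R^-1 ^+ N)%:E); last exact: prob_history.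
  rewrite -EFinM lee_fin expr0 mul1r mulrC.
  by rewrite ler_wpM2l ?exprn_ge0 ?invr_ge0// -lee_fin -phi_fin phi_le.
have mtraj : measurable_fun setT
    (fun w => phi (trajectory y (fun j => ik (N + j)%N w) k.+1)).
  move=> _ B mB; rewrite setTI.
  exact: (measurable_trajectory (phi @^-1` B) y N k.+1).
rewrite history_extend ge0_integral_bigsetU//=; first last.
- exact: measurable_funTS mtraj.
- exact: sub_trivIset (@trivIset_history N s).
- exact: index_enum_uniq.
- by move=> a; exact: measurable_history.
apply: (@le_trans _ _ (\sum_(a < m)
    (m%:R^-1 ^+ N.+1 * (rho ^+ k * V (step a y)))%:E)%E).
  apply: lee_sum => a _; apply: le_trans (IH _ N.+1 (extend N s a) (S_step a Sy)).
  rewrite le_eqVlt; apply/orP; left; apply/eqP; apply: eq_integral => w.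
  move=> /set_mem/(_ N (ltnSn N)); rewrite /= /extend ltnn => ika.
  by rewrite -/(trajectory y _ k.+1) trajectory_shift ika.
rewrite sumEFin lee_fin -2!mulr_sumr.
apply: (@le_trans _ _ (m%:R^-1 ^+ N.+1 * (rho ^+ k * (m%:R * (rho * V y))))).
  by rewrite !ler_wpM2l ?exprn_ge0 ?invr_ge0// V_step.
rewrite le_eqVlt !exprS; apply/orP; left; apply/eqP; field.
by rewrite pnatr_eq0 -lt0n.
Qed.

Lemma expectation_trajectory_le k y : S y ->
  (\int[P]_w phi (trajectory y (ik^~ w) k) <= (rho ^+ k * V y)%:E)%E.
Proof.
move=> Sy; have := @integral_trajectory_le k y 0 (fun=> Ordinal m_gt0) Sy.
rewrite expr0 mul1r; congr (integral _ _ _ <= _)%E.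
by apply/seteqP; split => // w _ j.
Qed.

End RandomTrajectory.

(** * The convergence rate *)

Lemma rcd_trajectory {R : realType} (m n : nat) (X : 'I_m -> set 'rV[R]_n) g y s k :
  rcd X g y s k = trajectory (rcd_step X g) y s k.
Proof. by elim: k => //= k ->. Qed.

Theorem theorem4 (R : realType) (m n : nat) (X : 'I_m -> set 'rV[R]_n)
  (X_closed : forall i, closed (X i))
  (X_convex : forall i, convex_set (X i : set (convex_lmodType 'rV[R]_n)))
  (r : nat) (r_range : (1 <= r <= m)%N)
  (X_polyhedral : forall i : 'I_m, (r <= i)%N -> polyhedral (X i))
  (X_regular : exists xbar : 'rV[R]_n,
     (forall i : 'I_m, (i < r)%N -> relint (X i) xbar) /\
     (forall i : 'I_m, (r <= i)%N -> X i xbar))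
  (g : 'rV[R]_n -> R) (L : R)
  (g_strongly_convex : strongly_convex 1 g)
  (g_smooth : lipschitz_gradient L g)
  (y0 : 'M[R]_(m, n)) (sigma : R) (sigma_gt0 : 0 < sigma)
  (quadratic_growth : forall y : 'M[R]_(m, n),
     (dual X g y <= dual X g y0)%E ->
     (dual X g y - dual_opt X g >=
        (sigma / 2)%:E * dist y (dual_sol X g) ^+ 2)%E)
  (dis : measure_display) (Omega : measurableType dis)
  (P : probability Omega R) (ik : nat -> Omega -> 'I_m)
  (ik_sampling : iid_uniform P ik) (k : nat) :
  (\int[P]_w (dual X g (rcd X g y0 (fun j => ik j w) k) - dual_opt X g) <=
   ((1 - sigma / (m%:R * (sigma + 1))) ^+ k)%:E *
     (dual X g y0 - dual_opt X g
      + (2^-1)%:E * dist y0 (dual_sol X g) ^+ 2))%E.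
Proof.
have m_gt0 : (0 < m)%N by case/andP: r_range; exact: leq_trans.
have X_common : exists x, forall i, X i x.
  have [x [x_lt x_ge]] := X_regular; exists x => i.
  by have [/x_lt[]|/x_ge] := ltnP i r.
have [g_diff _] := g_smooth.
have cg : continuous g by move=> x; exact: differentiable_continuous (g_diff x).
have scg := g_strongly_convex.
have d_fin := dual_opt_fin X_common scg cg.
have mR : 1 <= m%:R :> R by rewrite ler1n.
set rho := 1 - _.
have rho_gt0 : 0 < rho.
  by rewrite subr_gt0 ltr_pdivrMr ?mul1r; nra.
set d := dual_opt X g in d_fin *; set Y := dual_sol X g in quadratic_growth *.
have gap_ge0 y : (0 <= dual X g y - d)%E by rewrite sube_ge0 ?d_fin ?dual_opt_le.
(* Unless both terms of the initial Lyapunov value are finite, the right-hand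
   side is +oo. *)
have [V_fin|V_infty] := boolP ((dual X g y0 - d < +oo)%E && (dist y0 Y < +oo)%E);
  last first.
  suff -> : (dual X g y0 - d + 2^-1%:E * dist y0 Y ^+ 2 = +oo)%E.
    by rewrite gt0_muley ?leey// lte_fin exprn_gt0.
  have dist0 := dist_ge0 y0 Y.
  move: V_infty; rewrite negb_and -!leNgt !leye_eq => /orP[/eqP ->|/eqP ->].
    rewrite addye// gt_eqF// (@lt_le_trans _ _ 0%E)// mule_ge0 ?lee_fin//.
    by rewrite expe_ge0.
  rewrite expe2 mulyy gt0_muley ?lte_fin ?invr_gt0// addey//.
  by rewrite gt_eqF// (@lt_le_trans _ _ 0%E).
have /andP[dual_lty dist_lty] := V_fin.
have Y_nonempty : Y !=set0.
  apply/set0P/eqP => Y0; move: dist_lty.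
  by rewrite /dist Y0 image_set0 ereal_inf0.
have dom0 : dual_dom X y0.
  apply: (dual_dom_lty X_common scg cg).
  rewrite ltNge leye_eq; apply: contraTN dual_lty => /eqP ->.
  by rewrite -[d]fineK// addye.
pose S y := dual_dom X y /\ dualR X g y <= dualR X g y0.
have -> : (dual X g y0 - d + 2^-1%:E * dist y0 Y ^+ 2 = (lyapunov X g y0)%:E)%E.
  rewrite /lyapunov (dual_fin scg cg dom0) -[d]fineK//.
  by rewrite (dist_fin y0 Y_nonempty) -EFin_expe.
rewrite -EFinM; under eq_integral do rewrite rcd_trajectory.
apply: (@expectation_trajectory_le _ _ _ P m ik ik_sampling _ (rcd_step X g)
  (fun y => dual X g y - d)%E (lyapunov X g) S rho) => //.
- exact: ltW.
- move=> a y [dom_y y_le]; split; first exact: rcd_step_dom.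
  apply: le_trans y_le; exact: rcd_step_descent.
- move=> y [dom_y _]; rewrite /lyapunov (dual_fin scg cg dom_y).
  rewrite -[d]fineK// -EFinB lee_fin lerDl mulr_ge0// sqr_ge0//.
- move=> y [dom_y y_le]; apply: lyapunov_step => //.
  have := quadratic_growth y; rewrite -/d !(dual_fin scg cg)//.
  rewrite lee_fin => /(_ y_le); rewrite -[d]fineK// (dist_fin y Y_nonempty).
  by rewrite -EFin_expe -EFinB -EFinM lee_fin.
Qed.
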